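(* Let $\mathcal S$ be a set of random variables on an atomless probability space $(\Omega,\mathcal F,\mathbb P)$. The following statements are equivalent. (i) $\mathcal S$ is uniformly integrable. (ii) $\sup_{X\in\mathcal S}(1-p)\,\mathrm{ES}_p(|X|)$ tends to $0$ as $p\uparrow1$. (iii) Both $\sup_{X\in\mathcal S}(1-p)\,\mathrm{ES}_p(X)$ and $\sup_{X\in\mathcal S}(1-p)\,\mathrm{ES}_p(-X)$ tend to $0$ as $p\uparrow1$.
   Context: Random variables are real-valued and almost surely equal ones are identified. A set $\mathcal S$ of random variables is uniformly integrable if $\sup_{X\in\mathcal S}\mathbb E[|X|\mathbf 1_{\{|X|>K\}}]\to0$ as $K\to\infty$. For $p\in(0,1)$ and any random variable $X$, $\mathrm{VaR}_p(X)=\inf\{x\in\mathbb R:\mathbb P(X\le x)\ge p\}$ and $$\mathrm{ES}_p(X)=\frac1{1-p}\int_p^1\mathrm{VaR}_q(X)\,dq\in(-\infty,\infty].$$ Here $\mathrm{ES}_p$ is defined on all random variables and may take the value $+\infty$. *)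

(* Defs.v *)
From HB Require Import structures.
From mathcomp Require Import all_boot all_order all_algebra.
From mathcomp Require Import all_classical all_reals all_analysis.

Set Implicit Arguments.
Unset Strict Implicit.
Unset Printing Implicit Defensive.

Import Order.TTheory GRing.Theory Num.Theory.
Import numFieldNormedType.Exports.

Local Open Scope classical_set_scope.
Local Open Scope ring_scope.
Local Open Scope ereal_scope.

Definition atomless (d : measure_display) (T : measurableType d) (R : realType)
    (P : probability T R) : Prop :=
  forall A : set T, measurable A -> 0 < P A ->
    exists B : set T, [/\ measurable B, B `<=` A, 0 < P B & P B < P A].

Section risk_measures.
Context {d : measure_display} {T : measurableType d} {R : realType}.
Variable P : probability T R.

(* A set of random variables is given by representatives: every quantity below
   depends on a random variable only up to almost sure equality.
   All suprema are taken in the extended reals, with supremum -oo over the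
   empty set. *)

Definition uniformly_integrable (S : set {RV P >-> R}) : Prop :=
  ereal_sup [set 'E_P[fun w => (`|X w| * \1_[set v | (K < `|X v|)%R] w)%R]
            | X in S] @[K --> +oo%R] --> 0.

(* As for 'E_P[X], the argument is a bare function, meant to be measurable; the
   probability below is then cdf X x.  For 0 < p < 1 the set of such x is
   nonempty and bounded below, so the extended-real infimum is the infimum
   in R. *)
Definition VaR (p : R) (X : T -> R) : \bar R :=
  ereal_inf [set x%:E | x in [set x : R | p%:E <= P [set w | (X w <= x)%R]]].

(* For 0 < p < 1 the integrand is bounded below on ]p, 1[ by VaR p X, so the
   integral is well defined, with a value in ]-oo, +oo]. *)
Definition ES (p : R) (X : T -> R) : \bar R :=
  ((1 - p)^-1)%:E * \int[lebesgue_measure]_(q in `]p, 1%R[) VaR q X.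

End risk_measures.

(* Main.v *)
(* For [q] uniform on ]0, 1[, the variable [VaR_q X] has the law of [X].  Since
   [(1 - p) ES_p X] is the integral of [VaR_q X] over ]p, 1[, this compares it with
   the tail expectation of [X]:
   - it is at most [(1 - p) K + E[|X|; |X| > K]] for every [K >= 0];
   - if [(1 - p) ES_p X <= e], then [VaR_p X <= e / (1 - p)], so that for
     [K >= e / (1 - p)] the quantiles exceeding [K] lie in ]p, 1[, and
     [E[X; X > K]] is at most the integral of [(VaR_q X)^+] over ]p, 1[.
   For the implication from (iii), the integral of [(VaR_q X)^-] over ]p, 1[ is
   negligible, uniformly in [X], because the bound on [- X] bounds the quantiles
   of [X] of level close to 1 from below. *)
Require Import Defs.
From HB Require Import structures.
From mathcomp Require Import all_boot all_order all_algebra.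
From mathcomp Require Import all_classical all_reals all_analysis.
From mathcomp Require Import measurable_realfun.
From mathcomp Require Import lra.

Set Implicit Arguments.
Unset Strict Implicit.
Unset Printing Implicit Defensive.

Import Order.TTheory GRing.Theory Num.Theory.
Import numFieldNormedType.Exports.

Local Open Scope classical_set_scope.
Local Open Scope ring_scope.
Local Open Scope ereal_scope.

(** * Truncation above a level *)

Section upper_tail.
Context {d : measure_display} {T : measurableType d} {R : realType}.
Variables (K : R) (h : T -> R).

Lemma mul_indic_gtE w :
  (h w * \1_[set v | (K < h v)%R] w = if K < h w then h w else 0)%R.
Proof.
rewrite indicE; case: ifPn => Kh; first by rewrite mem_set ?mulr1.
by rewrite memNset ?mulr0//=; exact/negP.
Qed.

Lemma mul_indic_gt_ge0 w : (0 <= K)%R ->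
  0 <= (h w * \1_[set v | (K < h v)%R] w)%:E.
Proof.
move=> K0; rewrite lee_fin mul_indic_gtE.
by case: ifPn => // /ltW; exact: le_trans.
Qed.

Lemma measurable_mul_indic_gt : measurable_fun setT h ->
  measurable_fun setT (fun w => (h w * \1_[set v | (K < h v)%R] w)%:E).
Proof.
move=> mh; apply/measurable_EFinP; apply: measurable_funM => //.
apply: measurable_indic.
rewrite [X in measurable X](_ : _ = [set: T] `&` h @^-1` `]K, +oo[).
  exact: mh.
by rewrite setTI; apply/seteqP; split=> w /=; rewrite in_itv/= andbT.
Qed.

End upper_tail.

(** * Quantile functions and their integrals near level 1 *)

Section quantile.
Context {d : measure_display} {T : measurableType d} {R : realType}.
Variables (P : probability T R) (X : {RV P >-> R}).

Let sublevelE x : P [set w | (X w <= x)%R] = cdf X x.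
Proof. by rewrite /cdf /distribution /pushforward; congr (P _). Qed.

(** Galois connection between quantile function and cdf; right continuity of the cdf makes the
    infimum attained, which gives the direct implication. *)
Lemma VaR_leP (q x : R) : (VaR P q X <= x%:E) = (q%:E <= cdf X x).
Proof.
apply/idP/idP => [VaRx|qF]; last first.
  by apply: ereal_inf_lbound; exists x => //=; rewrite sublevelE.
have : cdf X y @[y --> x^'+] --> cdf X x by exact: cdf_right_continuous.
apply: cvge_ge; near=> y.
have xy : (x < y)%R by near: y; exact: nbhs_right_gt.
have /ereal_inf_ltP[_ [z /= + <-]] : VaR P q X < y%:E.
  by rewrite (le_lt_trans VaRx) ?lte_fin.
rewrite sublevelE lte_fin => qz zy.
by rewrite (le_trans qz)// cdf_nondecreasing// ltW.
Unshelve. all: by end_near. Qed.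

Lemma le_VaR (p q : R) : (p <= q)%R -> VaR P p X <= VaR P q X.
Proof.
move=> pq; apply: ereal_inf_le_tmp => _ [x /= qx <-]; exists x => //=.
by rewrite (le_trans _ qx)// lee_fin.
Qed.

Lemma VaR_fin_num (q : R) : (0 < q < 1)%R -> VaR P q X \is a fin_num.
Proof.
move=> /andP[q0 q1].
have [x xq] : exists x, q%:E <= cdf X x.
  apply: contrapT => /forallNP qF; move: q1; rewrite -lte_fin ltNge => /negP; apply.
  apply: (cvge_le _ (cvg_cdfy1 X)).
  by near=> y; rewrite leNgt; apply/negP => /ltW/qF.
have [y yq] : exists y, cdf X y < q%:E.
  apply: contrapT => /forallNP qF; move: q0; rewrite -lte_fin ltNge => /negP; apply.
  apply: (cvge_ge _ (cvg_cdfNy0 X)).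
  by near=> y; rewrite leNgt; apply/negP/qF.
rewrite fin_numE; apply/andP; split.
  by rewrite gt_eqF// (@lt_trans _ _ y%:E) ?ltNyr// ltNge VaR_leP -ltNge.
by rewrite lt_eqF// (@le_lt_trans _ _ x%:E) ?ltry// VaR_leP.
Unshelve. all: by end_near. Qed.

Lemma measurable_VaR : measurable_fun [set: R] ((VaR P)^~ X).
Proof.
apply: (measurability (@ErealGenOInfty.G R)) => [|/= _ [_] [r] -> <-].
  exact: ErealGenOInfty.measurableE.
rewrite setTI [X in measurable X](_ : _ = `](fine (cdf X r)), +oo[%classic)//.
have E q : (r%:E < VaR P q X) = (fine (cdf X r) < q)%R.
  by rewrite ltNge VaR_leP -ltNge -lte_fin fineK ?fin_num_measure.
by apply/seteqP; split=> q /=; rewrite !in_itv/= !andbT E.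
Qed.

Local Notation mu := (@lebesgue_measure R).

(** Inverse transform sampling: the quantile at a uniform level has the law of [X]. Taking [fine] is
    harmless since quantiles are finite on ]0, 1[. *)
Lemma ge0_integral_VaR (g : R -> \bar R) :
    measurable_fun setT g -> (forall x, 0 <= g x) ->
  \int[P]_w g (X w) = \int[mu]_(q in `]0%R, 1%R[) g (fine (VaR P q X)).
Proof.
move=> mg g0.
(* [uniform_prob] lives on [measurableTypeR R], whose display is not that of [R]. *)
pose u (q : measurableTypeR R) : R := fine (VaR P q X).
have mU : measurable_fun setT u.
  by apply: measurableT_comp => //; exact: measurable_VaR.
pose Q := uniform_prob (@ltr01 R).
have QE f : measurable_fun [set: R] f -> (forall x, 0 <= f x) ->
    \int[Q]_x f x = \int[mu]_(x in `]0%R, 1%R[) f x.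
  move=> mf f0; rewrite integral_uniform// subr0 invr1 mul1e.
  by rewrite integral_itv_bndoo//; exact: measurable_funTS.
pose U : {mfun measurableTypeR R >-> R} :=
  HB.pack u
    (isMeasurableFun.Build _ _ _ _ _ mU).
rewrite -QE//; last exact: measurableT_comp.
rewrite -[LHS](ge0_integral_distribution X mg g0).
rewrite -[RHS](@ge0_integral_distribution _ _ _ _ _ Q U g mg g0).
apply: eq_measure_integral => A mA _.
(* Both laws are compared on the rays ]x, +oo[, a generating family stable under intersection. *)
apply: (measure_unique (@RGenOInfty.G R)
  (fun n => `](- n%:R)%R, +oo[%classic)) => //.
- exact: RGenOInfty.measurableE.
- move=> _ _ [x ->] [y ->]; exists (Num.max x y).
  by apply/seteqP; split=> z /=; rewrite !in_itv/= !andbT gt_max => /andP.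
- by move=> n; exists (- n%:R)%R.
- rewrite -subTset => x _; exists (Num.bound `|x|%R) => //=.
  by rewrite in_itv/= andbT ltrNl (le_lt_trans (ler_norm _))// normrN archi_boundP.
- move=> _ [x ->]; transitivity (ccdf X x) => //; rewrite ccdf_1_cdf.
  have /andP[F0 F1] : (0 <= fine (cdf X x) <= 1)%R.
    by rewrite -!lee_fin fineK ?fin_num_measure// cdf_ge0 cdf_le1.
  rewrite /distribution /pushforward; set B := (X in _ = Q X).
  have mB : measurable B by rewrite -[B]setTI; exact: (mU measurableT).
  have -> : Q B = \int[Q]_x (\1_B x)%:E by rewrite integral_indic// setIT.
  rewrite QE; last 2 first.
  - exact/measurable_EFinP/measurable_indic.
  - by move=> q; rewrite lee_fin.
  (* By [VaR_leP], the levels in ]0, 1[ whose quantile exceeds [x] form ]F(x), 1[, with F the cdf;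
     this interval is empty when F(x) = 1. *)
  rewrite integral_indic//; transitivity (mu `](fine (cdf X x)), 1%R[%classic).
    rewrite lebesgue_measure_itv/= lte_fin; case: ltgtP F1 => // [_ _|F1 _].
    - by rewrite EFinN fineK ?fin_num_measure.
    - by rewrite -[cdf X x]fineK ?fin_num_measure// F1 subee.
  have E q : (0 < q < 1)%R -> (x < u q)%R = (fine (cdf X x) < q)%R.
    move=> q01; rewrite -lte_fin fineK ?VaR_fin_num// ltNge VaR_leP -ltNge.
    by rewrite -[in LHS](fineK (_ : cdf X x \is a fin_num)) ?fin_num_measure.
  congr (_ _); apply/seteqP; split=> q; rewrite /B /= !in_itv/= andbT.
    move=> /andP[Fq q1]; have q01 : (0 < q < 1)%R by rewrite q1 (le_lt_trans F0).
    by split=> //; rewrite E.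
  by move=> [+ q01]; rewrite E// => ->; case/andP: q01.
- by move=> n; rewrite (le_lt_trans (probability_le1 _ _))// ltry.
Qed.
Lemma scaled_ESE (p : R) : (p < 1)%R ->
  (1 - p)%:E * ES P p X = \int[mu]_(q in `]p, 1%R[) VaR P q X.
Proof.
by move=> p1; rewrite /ES muleA -EFinM mulfV ?mul1e// subr_eq0 gt_eqF.
Qed.

Let f := (VaR P)^~ X.

Let mf D : measurable_fun D f.
Proof. by apply: measurable_funTS; exact: measurable_VaR. Qed.

Let mfp D : measurable_fun D f^\+.
Proof. by apply: measurable_funepos; exact: mf. Qed.

Let mfn D : measurable_fun D f^\-.
Proof. by apply: measurable_funeneg; exact: mf. Qed.

Let int_cst (p c : R) : (p < 1)%R ->
  \int[mu]_(q in `]p, 1%R[) c%:E = ((1 - p) * c)%:E.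
Proof.
by move=> p1; rewrite integral_cst//= lebesgue_measure_itv/= lte_fin p1 -EFinM mulrC.
Qed.

Lemma int_VaR_neg_le (p M : R) :
  (p < 1)%R -> (0 <= M)%R -> (- M)%:E <= VaR P p X ->
  \int[mu]_(q in `]p, 1%R[) f^\- q <= ((1 - p) * M)%:E.
Proof.
move=> p1 M0 MV; rewrite -int_cst//; apply: ge0_le_integral => //.
- exact: mfn.
- move=> q /=; rewrite in_itv/= => /andP[pq _].
  rewrite funenegE ge_max lee_fin M0 andbT leeNl -EFinN.
  by rewrite (le_trans MV)// le_VaR// ltW.
Qed.

Lemma int_VaR_ge (p m : R) : (p < 1)%R -> m%:E <= VaR P p X ->
  ((1 - p) * m)%:E <= \int[mu]_(q in `]p, 1%R[) VaR P q X.
Proof.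
move=> p1 mV; have [m0|m0] := leP 0%R m.
  rewrite -int_cst//; apply: ge0_le_integral => //.
  - exact: mf.
  - move=> q /=; rewrite in_itv/= => /andP[pq _].
    by rewrite (le_trans mV)// le_VaR// ltW.
(* For [m < 0] the positive part is dropped and the negative part is at most [- m]. *)
rewrite integralE -[leLHS]add0e; apply: leeD; first exact: integral_ge0.
rewrite -(opprK m) mulrN EFinN leeN2.
by apply: int_VaR_neg_le; rewrite ?opprK// oppr_ge0 ltW.
Qed.

(** The integral of the negative part is added back; it is finite, so the cancellation is valid even
    if the positive part has infinite integral. *)
Lemma int_VaR_pos_le (p M : R) :
  (p < 1)%R -> (0 <= M)%R -> (- M)%:E <= VaR P p X ->
  \int[mu]_(q in `]p, 1%R[) f^\+ q <=
  \int[mu]_(q in `]p, 1%R[) VaR P q X + ((1 - p) * M)%:E.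
Proof.
move=> p1 M0 MV; rewrite [in leRHS]integralE.
have NM := int_VaR_neg_le p1 M0 MV.
have N0 : 0 <= \int[mu]_(q in `]p, 1%R[) f^\- q by exact: integral_ge0.
rewrite -addeA -[leLHS]adde0; apply: leeD => //.
rewrite addeC sube_ge0// ge0_fin_numE//.
by rewrite (le_lt_trans NM) ?ltry.
Qed.

(** Truncation as a function of a real, so that [ge0_integral_VaR] applies with [g := tail K]. *)
Let tail (K x : R) : \bar R := (x * \1_[set y | (K < y)%R] x)%:E.

Let measurable_tail K : measurable_fun setT (tail K).
Proof. exact: measurable_mul_indic_gt. Qed.

Let tail_ge0 (K x : R) : (0 <= K)%R -> 0 <= tail K x.
Proof. exact: mul_indic_gt_ge0. Qed.

Let tailE (K x : R) : tail K x = (if (K < x)%R then x else 0%R)%:E.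
Proof. by rewrite /tail (mul_indic_gtE K id). Qed.

Lemma int_VaR_le_tail (p K : R) : (0 < p < 1)%R -> (0 <= K)%R ->
  \int[mu]_(q in `]p, 1%R[) VaR P q X <=
  ((1 - p) * K)%:E + 'E_P[fun w => (`|X w| * \1_[set v | (K < `|X v|)%R] w)%R].
Proof.
move=> /andP[p0 p1] K0.
have m01 D : measurable_fun D (fun q => tail K (fine (VaR P q X))).
  apply: measurableT_comp => //; apply: measurableT_comp => //; exact: mf.
have p01 q : (p < q < 1)%R -> (0 < q < 1)%R.
  by move=> /andP[pq ->]; rewrite (lt_trans p0).
apply: (@le_trans _ _ (\int[mu]_(q in `]p, 1%R[) f^\+ q)).
  rewrite integralE geeDl// leeNl oppe0; exact: integral_ge0.
(* Pointwise, the positive part of a quantile is at most [K] plus its truncation above [K]. *)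
apply: (@le_trans _ _
    (\int[mu]_(q in `]p, 1%R[) (K%:E + tail K (fine (VaR P q X))))).
  apply: ge0_le_integral => //.
  - exact: mfp.
  - by apply: emeasurable_funD => //; exact: m01.
  - move=> q /=; rewrite in_itv/= => /p01 q01.
    rewrite funeposE /f -[VaR P q X]fineK ?VaR_fin_num//=.
    rewrite tailE -EFinD -EFin_max lee_fin ge_max.
    by case: ifPn => [/ltW|]; rewrite -?leNgt; lra.
rewrite ge0_integralD//; [|by move=> q _; exact: tail_ge0|exact: m01].
rewrite int_cst// leeD2l//.
apply: (@le_trans _ _ (\int[mu]_(q in `]0%R, 1%R[) tail K (fine (VaR P q X)))).
  apply: ge0_subset_integral => //; first exact: m01.
  by move=> q _; exact: tail_ge0.
rewrite -ge0_integral_VaR//; last by move=> x; exact: tail_ge0.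
rewrite unlock; apply: ge0_le_integral => //.
- by move=> w _; exact: tail_ge0.
- exact: measurableT_comp.
- by apply: measurable_mul_indic_gt; exact: measurableT_comp.
- move=> w _; rewrite tailE lee_fin indicE.
  case: ifPn => [KX|_]; last by rewrite mulr_ge0.
  by rewrite mem_set ?mulr1 ?ler_norm//= (lt_le_trans KX) ?ler_norm.
Qed.

Lemma tail_le_int_VaR (p K : R) :
  (0 < p < 1)%R -> (0 <= K)%R -> VaR P p X <= K%:E ->
  \int[P]_w (X w * \1_[set v | (K < X v)%R] w)%:E <=
  \int[mu]_(q in `]p, 1%R[) f^\+ q.
Proof.
move=> /andP[p0 p1] K0 VK.
rewrite -[leLHS]/(\int[P]_w tail K (X w)).
rewrite ge0_integral_VaR//; last by move=> x; exact: tail_ge0.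
(* Both integrands are extended by 0 to compare them level by level: at levels up to [p] the
   quantile is at most [K], so its truncation vanishes. *)
rewrite integral_mkcond [leRHS]integral_mkcond; apply: ge0_le_integral => //.
- by move=> q _; apply: erestrict_ge0 => ? _; exact: tail_ge0.
- apply/(measurable_restrictT _ _).1 => //; apply: measurableT_comp => //.
  by apply: measurableT_comp => //; exact: mf.
- by apply/(measurable_restrictT _ _).1 => //; exact: mfp.
move=> q _; rewrite !patchE; case: ifPn => [|_]; last first.
  by case: ifPn => // _; exact: funepos_ge0.
rewrite inE/= in_itv/= => q01; have [pq|qp] := ltP p q.
  rewrite mem_set/=; last by rewrite in_itv/= pq; case/andP: q01.
  rewrite funeposE /f -[VaR P q X]fineK ?VaR_fin_num//=.
  rewrite tailE -EFin_max lee_fin le_max.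
  by case: ifPn => _; rewrite lexx ?orbT.
rewrite memNset/=; last by rewrite in_itv/= ltNge qp.
rewrite tailE ifN// -leNgt -lee_fin fineK ?VaR_fin_num//.
by rewrite (le_trans _ VK)// le_VaR.
Qed.

(** Quantiles increase with the level, so the integral over ]p, 1[ is at least [1 - p] times the
    quantile at [p]. *)
Lemma VaR_le_of_ES (p e : R) : (0 < p < 1)%R -> (0 <= e)%R ->
  (1 - p)%:E * ES P p X <= e%:E -> VaR P p X <= (e / (1 - p))%:E.
Proof.
move=> p01 e0; have p1 : (p < 1)%R by case/andP: p01.
have p10 : (0 < 1 - p)%R by rewrite subr_gt0.
rewrite scaled_ESE// -[VaR P p X]fineK ?VaR_fin_num// lee_fin => Ae.
rewrite ler_pdivlMr// mulrC -lee_fin (le_trans _ Ae)// int_VaR_ge//.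
by rewrite fineK ?VaR_fin_num.
Qed.

Lemma VaR_ge0 (q : R) : (0 < q)%R -> (forall w, 0 <= X w)%R -> 0 <= VaR P q X.
Proof.
move=> q0 X0; apply: le_ereal_inf_tmp => _ [x /= qx <-].
rewrite lee_fin leNgt; apply/negP => x0; move: qx.
rewrite [X in P X](_ : _ = set0) ?measure0 ?lee_fin ?leNgt ?q0//.
by apply/seteqP; split=> w //= /(le_trans (X0 w)); rewrite leNgt x0.
Qed.

(** If [x < - M], the events [Y <= x] and [X <= M] are disjoint, and their probabilities, at least
    [q] and [p], would add up to more than 1. *)
Lemma VaR_opp_ge (Y : {RV P >-> R}) (p q M : R) : (forall w, Y w = - X w)%R ->
  (1 - p < q)%R -> VaR P p X <= M%:E -> (- M)%:E <= VaR P q Y.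
Proof.
move=> YX pq; rewrite VaR_leP => pM; apply: le_ereal_inf_tmp => _ [x /= qx <-].
rewrite lee_fin leNgt; apply/negP => xM; move: pq; apply/negP; rewrite -leNgt.
have mY : measurable [set w | (Y w <= x)%R].
  rewrite -[X in measurable X]setTI.
  exact: (measurable_funPT Y measurableT `]-oo, x]%classic).
have mX : measurable (X @^-1` `]-oo, M]%classic).
  rewrite -[X in measurable X]setTI.
  exact: (measurable_funPT X measurableT `]-oo, M]%classic).
rewrite lerBrDr -lee_fin EFinD (le_trans (leeD qx pM))// -measureU//.
  by apply: probability_le1; exact: measurableU.
by apply/seteqP; split=> w //= []; rewrite in_itv/= YX; lra.
Qed.

End quantile.

(** * Suprema tending to 0, and limits at level 1 *)

Section limits_of_suprema.
Context {R : realType} {I : Type} (F : set_system R) {FF : ProperFilter F}.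
Variables (A : set I) (g : R -> I -> \bar R).

(** The supremum of the empty set is -oo, which cannot converge to 0. *)
Lemma ereal_sup_cvg0_neq0 :
  ereal_sup [set g x i | i in A] @[x --> F] --> 0 -> A !=set0.
Proof.
move=> /fine_cvgP[+ _] => fin; apply/set0P/negP => /eqP A0.
have [x] := filter_ex fin.
by rewrite A0 image_set0 ereal_sup0.
Qed.

Lemma ereal_sup_cvg0_le (e : R) : (0 < e)%R ->
  ereal_sup [set g x i | i in A] @[x --> F] --> 0 ->
  \forall x \near F, forall i, A i -> g x i <= e%:E.
Proof.
move=> e0 /fine_cvgP[fin /cvgrPdist_le/(_ _ e0) cvg0]; near=> x => i Ai.
apply: (@le_trans _ _ (ereal_sup [set g x i | i in A])).
  by apply: ereal_sup_ubound; exists i.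
rewrite -[leLHS]fineK; last by near: x.
rewrite lee_fin (le_trans (ler_norm _))// -normrN -sub0r.
by near: x.
Unshelve. all: by end_near. Qed.

(** The upper bound must be uniform, but a lower bound on a single member suffices, as the supremum
    dominates it. *)
Lemma ereal_sup_cvg0 (i0 : I) : A i0 ->
  (forall e : R, (0 < e)%R -> \forall x \near F, forall i, A i -> g x i <= e%:E) ->
  (forall e : R, (0 < e)%R -> \forall x \near F, (- e)%:E <= g x i0) ->
  ereal_sup [set g x i | i in A] @[x --> F] --> 0.
Proof.
move=> Ai0 ub lb.
have bnd (e : R) : (0 < e)%R ->
    \forall x \near F, (- e)%:E <= ereal_sup [set g x i | i in A] <= e%:E.
  move=> e0; near=> x; apply/andP; split.
    apply: (@le_trans _ _ (g x i0)); first by near: x; exact: lb.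
    by apply: ereal_sup_ubound; exists i0.
  apply: ge_ereal_sup => _ [i Ai <-]; move: i Ai.
  by near: x; exact: ub.
apply/fine_cvgP; split.
  have := bnd 1%R ltr01; apply: filterS => x /andP[? ?].
  by rewrite fin_numElt (lt_le_trans (ltNyr (- 1)%R))// (le_lt_trans _ (ltry 1%R)).
apply/cvgrPdist_le => e e0; have := bnd e e0; apply: filterS => x.
rewrite sub0r normrN ler_norml /=.
by case: (ereal_sup _) => [r||]; rewrite ?lee_fin ?leeNy_eq ?leye_eq ?andbF.
Unshelve. all: by end_near. Qed.

End limits_of_suprema.

Lemma near_left1_mul_le (R : realType) (c e : R) : (0 <= c)%R -> (0 < e)%R ->
  \forall p \near (1%R : R)^'-, ((1 - p) * c <= e)%R.
Proof.
(* Dividing by [c + 1] covers [c = 0] as well. *)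
move=> c0 e0; have c1 : (0 < c + 1)%R by rewrite ltr_wpDl.
near=> p; have : (1 - e / (c + 1) < p)%R.
  by near: p; apply: nbhs_left_gt; rewrite ltrBlDr ltrDl divr_gt0.
have p1 : (p < 1)%R by near: p; exact: nbhs_left_lt.
rewrite ltrBlDr -ltrBlDl ltr_pdivlMr// => /ltW; apply: le_trans.
by rewrite ler_wpM2l ?subr_ge0 ?(ltW p1)// lerDl.
Unshelve. all: by end_near. Qed.

Lemma near_left1_itv (R : realType) (a : R) : (a < 1)%R ->
  \forall p \near (1%R : R)^'-, (a < p < 1)%R.
Proof.
move=> a1; near=> p; apply/andP; split; near: p.
  exact: nbhs_left_gt.
exact: nbhs_left_lt.
Unshelve. all: by end_near. Qed.

(** * Passing between uniform integrability and expected shortfall *)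

Section uniform_integrability.
Context {d : measure_display} {T : measurableType d} {R : realType}.
Variables (P : probability T R) (S : set {RV P >-> R}).
Implicit Types (X : {RV P >-> R}) (Y : {RV P >-> R} -> {RV P >-> R}).

(** The map [Y] lets one proof serve [X], [- X] and the absolute value. First [K] makes the tail
    expectations at most [e / 2], then [p] close to 1 makes [(1 - p) * K] at most [e / 2]. *)
Lemma uniformly_integrable_ES Y : (forall X w, `|Y X w| = `|X w|)%R ->
  uniformly_integrable S ->
  ereal_sup [set (1 - p)%:E * ES P p (Y X) | X in S] @[p --> 1%R^'-] --> 0.
Proof.
move=> YX UI; have [X0 SX0] := ereal_sup_cvg0_neq0 UI.
apply: (ereal_sup_cvg0 SX0) => e e0.
  have e20 : (0 < e / 2)%R by rewrite divr_gt0.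
  have [K [K0 UIK]] : exists K : R, (0 <= K)%R /\ forall X, S X ->
      'E_P[fun w => (`|X w| * \1_[set v | (K < `|X v|)%R] w)%R] <= (e / 2)%:E.
    apply: (@filter_ex _ (pinfty_nbhs R)).
    apply: filterI; first exact/nbhs_pinfty_ge/num_real.
    exact: (ereal_sup_cvg0_le e20 UI).
  near=> p => X SX.
  have p01 : (0 < p < 1)%R by near: p; exact: near_left1_itv.
  rewrite scaled_ESE; last by case/andP: p01.
  rewrite (le_trans (int_VaR_le_tail _ p01 K0))// (splitr e) EFinD leeD//.
    by rewrite lee_fin; near: p; exact: near_left1_mul_le.
  by under eq_fun do rewrite YX; under eq_set do rewrite YX; exact: UIK.
(* Lower bound for one member: above level 1/2 its quantiles are at least the median [m], and
   [(1 - p) * m] tends to 0. *)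
pose m := fine (VaR P 2^-1 (Y X0)).
near=> p.
have /andP[p2 p1] : (2^-1 < p < 1)%R.
  by near: p; apply: near_left1_itv; rewrite invf_lt1// ltr1n.
rewrite scaled_ESE//; apply: (@le_trans _ _ ((1 - p) * m)%:E).
  rewrite lee_fin lerNl -mulrN (@le_trans _ _ ((1 - p) * `|m|)%R)//.
    by rewrite ler_wpM2l ?subr_ge0 ?(ltW p1)// -normrN ler_norm.
  by near: p; exact: near_left1_mul_le.
apply: int_VaR_ge => //; rewrite fineK ?le_VaR//; first exact: ltW.
by rewrite VaR_fin_num// invr_gt0 ltr0n invf_lt1// ltr1n.
Unshelve. all: by end_near. Qed.

Lemma ES_tail_le Y (M e : R) : (0 <= M)%R -> (0 < e)%R ->
  ereal_sup [set (1 - p)%:E * ES P p (Y X) | X in S] @[p --> 1%R^'-] --> 0 ->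
  (\forall p \near 1%R^'-, forall X, S X -> (- M)%:E <= VaR P p (Y X)) ->
  \forall K \near +oo%R, forall X, S X ->
    \int[P]_w (Y X w * \1_[set v | (K < Y X v)%R] w)%:E <= e%:E.
Proof.
move=> M0 e0 ES0 VM; have e20 : (0 < e / 2)%R by rewrite divr_gt0.
(* The level [p] is fixed before [K]: half of [e] bounds the scaled shortfall, the other half the
   negative parts of the quantiles. Then [K >= e / 2 / (1 - p)] puts every quantile at [p] below
   [K]. *)
have [p [[[p01 ESe] VMp] Me]] : exists p : R, (((0 < p < 1)%R /\
    forall X, S X -> (1 - p)%:E * ES P p (Y X) <= (e / 2)%:E) /\
    forall X, S X -> (- M)%:E <= VaR P p (Y X)) /\ ((1 - p) * M <= e / 2)%R.
  apply: (@filter_ex _ (at_left (1 : R)%R)).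
  apply: filterI; last exact: near_left1_mul_le.
  apply: filterI => //; apply: filterI; first exact: near_left1_itv.
  exact: (ereal_sup_cvg0_le e20 ES0).
have p1 : (p < 1)%R by case/andP: p01.
have K0 : (0 <= e / 2 / (1 - p))%R by rewrite divr_ge0 ?subr_ge0 ?(ltW p1)// ltW.
near=> K => X SX.
have KK : (e / 2 / (1 - p) <= K)%R by near: K; exact/nbhs_pinfty_ge/num_real.
rewrite (le_trans (tail_le_int_VaR p01 (le_trans K0 KK) _))//.
  by rewrite (le_trans (VaR_le_of_ES p01 (ltW e20) (ESe _ SX))).
rewrite (le_trans (int_VaR_pos_le p1 M0 (VMp _ SX)))//.
by rewrite (splitr e) EFinD leeD// -scaled_ESE// ESe.
Unshelve. all: by end_near. Qed.

(** One level [p] with scaled shortfall at most 1 bounds all quantiles of [Y X] at [p] by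
    [1 / (1 - p)]; [VaR_opp_ge] turns this into a lower bound for [Y' X] at levels above [1 - p]. *)
Lemma ES_opp_VaR_ge Y Y' : (forall X w, Y' X w = - Y X w)%R ->
  ereal_sup [set (1 - p)%:E * ES P p (Y X) | X in S] @[p --> 1%R^'-] --> 0 ->
  exists2 M : R, (0 <= M)%R &
    \forall p \near 1%R^'-, forall X, S X -> (- M)%:E <= VaR P p (Y' X).
Proof.
move=> YY' ES0.
have [p [p01 ESp]] : exists p : R, (0 < p < 1)%R /\
    forall X, S X -> (1 - p)%:E * ES P p (Y X) <= 1%:E.
  apply: (@filter_ex _ (at_left (1 : R)%R)).
  apply: filterI; first exact: near_left1_itv.
  exact: (ereal_sup_cvg0_le ltr01 ES0).
have /andP[p0 p1] := p01.
exists (1 / (1 - p))%R; first by rewrite divr_ge0// subr_ge0 (ltW p1).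
have : \forall q \near (1%R : R)^'-, (1 - p < q < 1)%R.
  by apply: near_left1_itv; rewrite ltrBlDr ltrDl.
apply: filterS => q /andP[pq _] X SX.
by apply: (VaR_opp_ge (YY' X) pq); apply: VaR_le_of_ES => //; exact: ESp.
Qed.

Lemma uniformly_integrable_near X0 : S X0 ->
  (forall e : R, (0 < e)%R -> \forall K \near +oo%R, forall X, S X ->
    'E_P[fun w => (`|X w| * \1_[set v | (K < `|X v|)%R] w)%R] <= e%:E) ->
  uniformly_integrable S.
Proof.
move=> SX0 ub; apply: (ereal_sup_cvg0 SX0) => // e e0; near=> K.
rewrite (@le_trans _ _ 0)//; first by rewrite lee_fin oppr_le0 ltW.
by rewrite unlock; apply: integral_ge0 => w _; rewrite lee_fin mulr_ge0.
Unshelve. all: by end_near. Qed.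

End uniform_integrability.

(** * Absolute value and opposite of a random variable *)

Section rv_operations.
Context {d : measure_display} {T : measurableType d} {R : realType}.
Variables (P : probability T R) (X : {RV P >-> R}).

Let measurable_abs : measurable_fun setT (fun w => `|X w|%R).
Proof. exact: measurableT_comp. Qed.

Let measurable_opp : measurable_fun setT (fun w => (- X w)%R).
Proof. exact: measurableT_comp. Qed.

(** Bundled so that the quantile lemmas apply; as a function it is convertible to the bare one in
    the theorem. *)
Definition rv_abs : {RV P >-> R} :=
  HB.pack (fun w => `|X w|%R) (isMeasurableFun.Build _ _ _ _ _ measurable_abs).

Definition rv_opp : {RV P >-> R} :=
  HB.pack (fun w => (- X w)%R) (isMeasurableFun.Build _ _ _ _ _ measurable_opp).

(** For [K >= 0], at most one of [X w] and [- X w] exceeds [K]. *)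
Lemma abs_tailE (K : R) : (0 <= K)%R ->
  'E_P[fun w => (`|X w| * \1_[set v | (K < `|X v|)%R] w)%R] =
  \int[P]_w (X w * \1_[set v | (K < X v)%R] w)%:E +
  \int[P]_w (rv_opp w * \1_[set v | (K < rv_opp v)%R] w)%:E.
Proof.
move=> K0; rewrite unlock -ge0_integralD//; last 4 first.
- by move=> w _; exact: mul_indic_gt_ge0.
- exact: measurable_mul_indic_gt.
- by move=> w _; exact: mul_indic_gt_ge0.
- exact: measurable_mul_indic_gt.
apply: eq_integral => w _; rewrite -EFinD; congr EFin.
rewrite (mul_indic_gtE K (fun v => `|X v|%R)) !mul_indic_gtE /=.
case: ler0P => X0.
  by rewrite [in RHS](ltNge K) (le_trans X0)//= add0r.
rewrite [Y in (_ = _ + Y)%R]ifN ?addr0// -leNgt.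
by rewrite (le_trans _ K0)// oppr_le0 ltW.
Qed.

End rv_operations.


Theorem theorem4p1 (d : measure_display) (T : measurableType d) (R : realType)
    (P : probability T R) (hP : atomless P) (S : set {RV P >-> R}) :
  (uniformly_integrable S <->
     ereal_sup [set (1 - p)%:E * ES P p (fun w => `|X w|%R) | X in S]
       @[p --> 1%R^'-] --> 0)
  /\
  (uniformly_integrable S <->
     (ereal_sup [set (1 - p)%:E * ES P p X | X in S] @[p --> 1%R^'-] --> 0
      /\
      ereal_sup [set (1 - p)%:E * ES P p (fun w => (- X w)%R) | X in S]
        @[p --> 1%R^'-] --> 0)).
Proof.
split; split.
- exact: (uniformly_integrable_ES (Y := @rv_abs _ _ _ P)
    (fun X w => normr_id _)).
- move=> ES0; have [X0 SX0] := ereal_sup_cvg0_neq0 ES0.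
  apply: (uniformly_integrable_near SX0) => e e0.
  (* Quantiles of a nonnegative variable are nonnegative, so [ES_tail_le] applies with [M = 0]. *)
  have V0 : \forall p \near (1%R : R)^'-, forall X, S X -> (- 0)%:E <= VaR P p (rv_abs X).
    have := near_left1_itv (@ltr01 R); apply: filterS => p /andP[p0 _] X _.
    by rewrite oppr0; apply: VaR_ge0 => // w; exact: normr_ge0.
  have := ES_tail_le (Y := @rv_abs _ _ _ P) (lexx 0%R) e0 ES0 V0.
  by apply: filterS => K XK X SX; rewrite unlock; exact: XK.
- move=> UI; split.
    exact: (uniformly_integrable_ES (Y := id)).
  exact: (uniformly_integrable_ES (Y := @rv_opp _ _ _ P)
    (fun X w => normrN _)).
- move=> [ES0 ESN0]; have [X0 SX0] := ereal_sup_cvg0_neq0 ES0.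
  apply: (uniformly_integrable_near SX0) => e e0.
  have e20 : (0 < e / 2)%R by rewrite divr_gt0.
  (* The hypotheses are used crosswise: the one on [X] bounds the quantiles of [- X] from below, and
     conversely. Each one-sided tail then gets [e / 2]. *)
  have [M M0 VM] := ES_opp_VaR_ge (Y := id) (Y' := @rv_opp _ _ _ P)
    (fun X w => erefl) ES0.
  have [N N0 VN] := ES_opp_VaR_ge (Y := @rv_opp _ _ _ P) (Y' := id)
    (fun X w => esym (opprK _)) ESN0.
  have ub := ES_tail_le (Y := id) N0 e20 ES0 VN.
  have ubN := ES_tail_le (Y := @rv_opp _ _ _ P) M0 e20 ESN0 VM.
  near=> K => X SX; rewrite abs_tailE; last first.
    by near: K; exact/nbhs_pinfty_ge/num_real.
  rewrite (splitr e) EFinD leeD//; move: X SX; near: K; [exact: ub|exact: ubN].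
Unshelve. all: by end_near. Qed.
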